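(* Let $F$ be monotone and $\ell$-star-cocoercive. Let the key parametric assumption hold with constants $A,B,C,D_1,D_2\ge0$, $\rho\in(0,1]$ and variables $\{\sigma_k\}_{k\ge0}$, and let $\mathcal{C}\subset\mathbb{R}^d$ be a compact convex set with $X^*\subset\mathcal{C}$ and diameter $\Omega_{\mathcal{C}}=\max_{x,y\in\mathcal{C}}\|x-y\|$. Assume that $$0<\gamma\le\frac{1}{2(A+BC/\rho)}.$$ Then for all $K\ge1$ the iterates of SGDA with constant stepsize $\gamma$ satisfy $$\begin{aligned}\mathbb{E}\left[\mathrm{Gap}_{\mathcal{C}}\left(\frac1K\sum_{k=1}^Kx^k\right)\right]\le\ &\frac{3\max_{u\in\mathcal{C}}\|x^0-u\|^2}{2\gamma K}+9\gamma\max_{x^*\in X^*}\|F(x^* )\|^2+\frac{8\gamma\ell^2\Omega_{\mathcal{C}}^2}{K}\\&+\left(4A+\ell+\frac{8BC}{\rho}\right)\frac{\|x^0-x^{*,0}\|^2}{K}+\left(4+\left(4A+\ell+\frac{8BC}{\rho}\right)\gamma\right)\frac{\gamma B\sigma_0^2}{\rho K}\\&+\gamma\left(2+\gamma\left(4A+\ell+\frac{8BC}{\rho}\right)\right)\left(D_1+\frac{2BD_2}{\rho}\right).\end{aligned}$$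
   Context: Norms and inner products on $\mathbb{R}^d$ are Euclidean. $F:\mathbb{R}^d\to\mathbb{R}^d$ is an operator and $R:\mathbb{R}^d\to\mathbb{R}\cup\{+\infty\}$ is a proper lower semicontinuous convex function. $X^*$ is the (nonempty) set of solutions of the regularized variational inequality: find $x^*\in\mathbb{R}^d$ with $\langle F(x^* ),x-x^*\rangle+R(x)-R(x^* )\ge0$ for all $x\in\mathbb{R}^d$. $\mathrm{proj}_{X^*}(x)=\arg\min_{y\in X^*}\|y-x\|$ (taken to be well defined). $F$ is monotone if $\langle F(x)-F(y),x-y\rangle\ge0$ for all $x,y$. $F$ is $\ell$-star-cocoercive ($\ell>0$) if $\|F(x)-F(x^* )\|^2\le\ell\langle F(x)-F(x^* ),x-x^*\rangle$ for all $x$, where $x^*=\mathrm{proj}_{X^*}(x)$. Restricted gap function: $\mathrm{Gap}_{\mathcal{C}}(z)=\max_{u\in\mathcal{C}}[\langle F(u),z-u\rangle+R(z)-R(u)]$ (maximum understood as supremum). SGDA: $x^{k+1}=\mathrm{prox}_{\gamma R}(x^k-\gamma g^k)$, where $\mathrm{prox}_{\gamma R}(x)=\arg\min_{y}\{R(y)+\|y-x\|^2/(2\gamma)\}$ and $g^k$ is a random vector; $x^0$ and $\sigma_0$ are deterministic. Put $x^{*,k}=\mathrm{proj}_{X^*}(x^k)$ and $g^{*,k}=F(x^{*,k})$. $\mathbb{E}_k[\cdot]$ is the expectation with respect to the randomness at iteration $k$, i.e. conditional on everything generated before iteration $k$ (in particular on $x^k,\sigma_k$). Key parametric assumption: for all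 $k\ge0$, $\mathbb{E}_k[g^k]=F(x^k)$, and there are constants $A,B,C,D_1,D_2\ge0$, $\rho\in(0,1]$ and (possibly random) nonnegative variables $\{\sigma_k\}_{k\ge0}$ such that for all $k\ge0$ $$\mathbb{E}_k\|g^k-g^{*,k}\|^2\le2A\langle F(x^k)-g^{*,k},x^k-x^{*,k}\rangle+B\sigma_k^2+D_1,$$ $$\mathbb{E}_k[\sigma_{k+1}^2]\le2C\langle F(x^k)-g^{*,k},x^k-x^{*,k}\rangle+(1-\rho)\sigma_k^2+D_2.$$ *)

(* Defs.v *)
From HB Require Import structures.
From mathcomp Require Import all_boot all_order all_algebra.
From mathcomp Require Import all_classical all_reals all_analysis.
From mathcomp Require Import measurable_realfun.

Set Implicit Arguments.
Unset Strict Implicit.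
Unset Printing Implicit Defensive.

Import Order.TTheory GRing.Theory Num.Theory.
Import numFieldNormedType.Exports.

Local Open Scope classical_set_scope.
Local Open Scope ring_scope.

(* The topology of 'rV[R]_n is the library's (that of the max norm, hence the
   usual one), but the library's norm `|v| on 'rV[R]_n is NOT Euclidean. *)
Section euclidean.
Context {R : realType} {n : nat}.
Implicit Types u v : 'rV[R]_n.

Definition dotv u v : R := \sum_(i < n) u 0 i * v 0 i.

Definition enorm v : R := Num.sqrt (dotv v v).

End euclidean.

Definition argmin {R : realType} {T : Type} (A : set T) (f : T -> \bar R) :
    set T :=
  [set y | A y /\ forall z, A z -> (f y <= f z)%E].

Section regularized_vi.
Context {R : realType} {n : nat}.
Local Notation V := 'rV[R]_n.
Implicit Types (F : V -> V) (r : V -> \bar R) (Xs C : set V).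

Definition proper_fun r :=
  (forall x, r x != -oo%E) /\ (exists x, r x != +oo%E).

(* At t = 0 and t = 1 this uses 0 * +oo = 0. *)
Definition convex_efun r := forall (x y : V) (t : R), 0 <= t <= 1 ->
  (r (t *: x + (1 - t) *: y)%R <= t%:E * r x + (1 - t)%:E * r y)%E.

(* In \bar R, +oo - +oo = -oo, so a point where r is +oo is never a solution. *)
Definition vi_solutions F r : set V :=
  [set xs | forall x, (0 <= (dotv (F xs) (x - xs))%:E + r x - r xs)%E].

Definition nearest Xs (x : V) : set V := argmin Xs (fun y => (enorm (y - x))%:E).

Definition proj_well_defined Xs := forall x, exists! y, nearest Xs x y.

Definition proj_on Xs (x : V) : V := get (nearest Xs x).

Definition monotone_op F := forall x y, 0 <= dotv (F x - F y) (x - y).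

Definition star_cocoercive F Xs (l : R) := forall x,
  enorm (F x - F (proj_on Xs x)) ^+ 2
    <= l * dotv (F x - F (proj_on Xs x)) (x - proj_on Xs x).

(* p = prox_{gamma r}(x), i.e. p minimizes r(y) + |y - x|^2 / (2 gamma). *)
Definition is_prox (gamma : R) r (x p : V) :=
  argmin setT (fun y => r y + (enorm (y - x) ^+ 2 / (2 * gamma))%:E)%E p.

(* For u in C with r u = +oo and r z finite the term is -oo. *)
Definition gap F r C (z : V) : \bar R :=
  ereal_sup [set ((dotv (F u) (z - u))%:E + r z - r u)%E | u in C].

Definition diameter C : \bar R :=
  ereal_sup [set e | exists x y, [/\ C x, C y & e = (enorm (x - y))%:E]].

End regularized_vi.

Section conditioning.
Context {d : measure_display} {T : measurableType d} {R : realType}.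

Definition filtration (G : nat -> set (set T)) := forall k,
  [/\ sigma_algebra setT (G k), G k `<=` measurable & G k `<=` G k.+1].

(* When G is a sigma-algebra, the measurable sets of g_sigma_algebraType G are
   exactly the elements of G. *)
Definition measurable_wrt {d'} {T' : measurableType d'} (G : set (set T))
    (X : T -> T') :=
  measurable_fun [set: g_sigma_algebraType G] (X : g_sigma_algebraType G -> T').

Definition vmeasurable_wrt {n} (G : set (set T)) (X : T -> 'rV[R]_n) :=
  forall i, measurable_wrt G (fun w => X w 0 i).

(* Y is a version of E[X | G].  To be used for X integrable, or for X
   measurable and nonnegative. *)
Definition cond_exp (P : probability T R) (G : set (set T))
    (X Y : T -> \bar R) :=
  measurable_wrt G Y /\
  forall A, G A -> (\int[P]_(w in A) Y w = \int[P]_(w in A) X w)%E.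

Definition vcond_exp {n} (P : probability T R) (G : set (set T))
    (X Y : T -> 'rV[R]_n) :=
  forall i, P.-integrable setT (fun w => (X w 0 i)%:E) /\
    cond_exp P G (fun w => (X w 0 i)%:E) (fun w => (Y w 0 i)%:E).

(* E[X | G] <= W almost surely, for X measurable and nonnegative. *)
Definition cond_exp_le (P : probability T R) (G : set (set T))
    (X W : T -> R) :=
  exists Y, cond_exp P G (fun w => (X w)%:E) Y /\
    {ae P, forall w, (Y w <= (W w)%:E)%E}.

End conditioning.

Section sgda.
Context {d : measure_display} {T : measurableType d} {R : realType} {n : nat}.
Local Notation V := 'rV[R]_n.

Definition sgda (gamma : R) (r : V -> \bar R) (x0 : V)
    (x g : nat -> T -> V) :=
  (forall w, x 0%N w = x0) /\
  (forall k w, is_prox gamma r (x k w - gamma *: g k w) (x k.+1 w)).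

(* G k is the information available before iteration k; the randomness of
   iteration k, i.e. g k and sigma (k+1), is revealed in G (k+1); hence
   conditioning on G k is E_k.  Xs is the solution set. *)
Record parametric_assumption (P : probability T R) (G : nat -> set (set T))
    (F : V -> V) (Xs : set V) (x g : nat -> T -> V) (sigma : nat -> T -> R)
    (A B C D1 D2 rho : R) : Prop := ParametricAssumption {
  pa_filtration : filtration G ;
  pa_x : forall k, vmeasurable_wrt (G k) (x k) ;
  pa_xstar : forall k, vmeasurable_wrt (G k) (fun w => proj_on Xs (x k w)) ;
  pa_gstar : forall k, vmeasurable_wrt (G k) (fun w => F (proj_on Xs (x k w))) ;
  pa_sigma : forall k, measurable_wrt (G k) (sigma k) ;
  pa_g : forall k, vmeasurable_wrt (G k.+1) (g k) ;
  pa_sigma_ge0 : forall k w, 0 <= sigma k w ;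
  pa_unbiased : forall k, vcond_exp P (G k) (g k) (fun w => F (x k w)) ;
  pa_second_moment : forall k, cond_exp_le P (G k)
    (fun w => enorm (g k w - F (proj_on Xs (x k w))) ^+ 2)
    (fun w => 2 * A * dotv (F (x k w) - F (proj_on Xs (x k w)))
                           (x k w - proj_on Xs (x k w))
              + B * sigma k w ^+ 2 + D1) ;
  pa_variance_reduction : forall k, cond_exp_le P (G k)
    (fun w => sigma k.+1 w ^+ 2)
    (fun w => 2 * C * dotv (F (x k w) - F (proj_on Xs (x k w)))
                           (x k w - proj_on Xs (x k w))
              + (1 - rho) * sigma k w ^+ 2 + D2)
}.

End sgda.

(* Main.v *)
(* For u in C, the prox inequality at step k tested against u and monotonicity
   bound 2 gamma (<F u, x_{k+1} - u> + r x_{k+1} - r u) by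
     |x_k - u|^2 - |x_{k+1} - u|^2 + gamma^2 |g_k|^2
       + 2 gamma <F u, x_{k+1} - x_k> + 2 gamma <g_k - F x_k, u - x_k>.
   Summing over k, the first and fourth terms telescope.  In the last one only
   <sum_k (g_k - F x_k), u - x_0> depends on u, and Young's inequality bounds it
   by |u - x_0|^2 + gamma^2 |sum_k (g_k - F x_k)|^2; the errors g_k - F x_k are
   orthogonal martingale differences, so the second moment of their sum is at
   most sum_k E |g_k - g*_k|^2.  Testing the prox inequality against x*_k instead
   gives a decrease of the Lyapunov function
   E |x_k - x*_k|^2 + (B / rho) gamma^2 E sigma_k^2, which bounds
   sum_k E <F x_k - g*_k, x_k - x*_k>, hence sum_k E |g_k - g*_k|^2.
   Star-cocoercivity gives |F u| <= |F u*| + l |u - u*| on C and propagates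
   square integrability along the iteration. *)

Require Import Defs.
From HB Require Import structures.
From mathcomp Require Import all_boot all_order all_algebra.
From mathcomp Require Import all_classical all_reals all_analysis.
From mathcomp Require Import measurable_realfun.
From mathcomp Require Import ring lra.

Set Implicit Arguments.
Unset Strict Implicit.
Unset Printing Implicit Defensive.

Import Order.TTheory GRing.Theory Num.Theory.
Import numFieldNormedType.Exports.

Local Open Scope classical_set_scope.
Local Open Scope ring_scope.

(** * Orthogonality of the conditional centering to measurable factors *)

Section real_random_variables.
Context {d : measure_display} {T : measurableType d} {R : realType}.
Context (P : probability T R).

Lemma sub_measurable_fun {d'} {T' : measurableType d'} (G : set (set T))
    (X : T -> T') :
  sigma_algebra setT G -> G `<=` measurable -> measurable_wrt G X ->
  measurable_fun setT X.
Proof.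
move=> sG Gm mX _ B mB; have := mX measurableT B mB.
by rewrite /measurable /= sigma_algebra_id// => /Gm.
Qed.

Lemma sub_measurable_wrt (G H : set (set T)) (X : T -> R) :
  sigma_algebra setT G -> sigma_algebra setT H -> G `<=` H ->
  measurable_wrt G X -> measurable_wrt H X.
Proof.
move=> sG sH GH mX _ B mB.
have := mX measurableT B mB.
by rewrite /measurable /= !sigma_algebra_id// => /GH.
Qed.

Import HBNNSimple.

(** Approximating [Z] from below by [G]-simple functions reduces the claim to integrals of [f] over
    sets of [G]; dominated convergence with bound [|f Z|] passes to the limit. *)
Let integral_mul_ge0_eq0 (G : set (set T)) (f Z : T -> R) :
  sigma_algebra setT G -> G `<=` measurable ->
  P.-integrable setT (EFin \o f) ->
  (forall A, G A -> \int[P]_(w in A) (f w)%:E = 0)%E ->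
  measurable_wrt G Z -> (forall w, 0 <= Z w) ->
  P.-integrable setT (fun w => (f w * Z w)%:E) ->
  (\int[P]_w (f w * Z w)%:E = 0)%E.
Proof.
move=> sG Gm fi f0 mZ Z0 fZi.
pose T' := g_sigma_algebraType G.
have mZ' : measurable_fun [set: T'] (EFin \o Z : T' -> \bar R).
  exact/measurable_EFinP.
(* The approximation lives on [T'], whose measurable sets are those of [G], so the level sets of
   every [h n] lie in [G]. *)
pose h := nnsfun_approx measurableT mZ'.
have Z0' (w : T') : [set: T'] w -> (0 <= (EFin \o Z) w)%E.
  by move=> _; rewrite lee_fin.
have mh n : measurable_fun setT (h n : T -> R).
  by apply: (sub_measurable_fun sG Gm); exact: measurable_funP.
have mf : measurable_fun setT f by apply/measurable_EFinP/(measurable_int P fi).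
have [//|||||_ _] := @dominated_convergence _ _ _ P setT measurableT
  (fun n w => (f w * h n w)%:E) (fun w => (f w * Z w)%:E)
  (fun w => `|f w * Z w|%:E).
- by move=> n; apply/measurable_EFinP; exact: measurable_funM.
- exact: (measurable_int P fZi).
- apply: aeW => w _.
  have := @cvg_nnsfun_approx _ _ _ _ measurableT _ mZ' Z0' w I.
  move=> /fine_cvgP[_] /= hZ.
  apply: cvg_EFin; first by near=> n.
  by apply: cvgMr; exact: hZ.
- exact: (integrable_abse fZi).
- apply: aeW => w n _; rewrite lee_fin !normrM ler_wpM2l//.
  have : ((h n w)%:E <= (Z w)%:E)%E.
    by rewrite /h nnsfun_approxE; exact: (le_approx n Z0' I).
  by rewrite lee_fin !ger0_norm.
have h0 n : (\int[P]_w (f w * h n w)%:E = 0)%E.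
  pose s := finmap.enum_fset (fset_set (range (h n))).
  have GA y : G (h n @^-1` [set y]).
    have := measurable_funP (h n) measurableT [set y] (measurable_set1 y).
    by rewrite setTI /measurable/= sigma_algebra_id.
  have fA y : P.-integrable setT ((EFin \o f) \_ (h n @^-1` [set y])).
    apply/(integrable_restrict P) => //; first exact: Gm.
    by rewrite setTI; apply: integrableS fi => //; exact: Gm.
  transitivity (\int[P]_w (\sum_(i < size s) (s`_i)%:E *
      ((EFin \o f) \_ ((h n : T -> R) @^-1` [set s`_i])) w))%E.
    apply: eq_integral => w _; rewrite (fimfunEord (h n)) mulr_sumr -sumEFin.
    apply: eq_bigr => i _; rewrite epatch_indic /= -!EFinM.
    by rewrite mulrCA.
  rewrite integral_sum//; last by move=> i; exact: integrableZl.
  rewrite big1// => i _; rewrite integralZl//.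
  by rewrite -integral_mkcond f0// mule0.
rewrite (_ : [sequence _]_n = cst 0%E); last by apply/funext => n /=; exact: h0.
by move=> /cvg_lim <-//; rewrite lim_cst.
Unshelve. all: by end_near. Qed.

(** Used with [f] a coordinate of [X - E[X | G]]. Splitting [Z] into [Z^\+] and [Z^\-] reduces to
    the nonnegative case; both products stay integrable since each part is at most [|Z|]. *)
Lemma integral_mul_eq0 (G : set (set T)) (f Z : T -> R) :
  sigma_algebra setT G -> G `<=` measurable ->
  P.-integrable setT (EFin \o f) ->
  (forall A, G A -> \int[P]_(w in A) (f w)%:E = 0)%E ->
  measurable_wrt G Z ->
  P.-integrable setT (fun w => (f w * Z w)%:E) ->
  \int[P]_w (f w * Z w) = 0.
Proof.
move=> sG Gm fi f0 mZ fZi.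
have mZp : measurable_wrt G Z^\+ by apply: measurable_funrpos.
have mZn : measurable_wrt G Z^\- by apply: measurable_funrneg.
have mf : measurable_fun setT f by apply/measurable_EFinP/(measurable_int P fi).
have bound (Z' : T -> R) : measurable_wrt G Z' -> (forall w, `|Z' w| <= `|Z w|) ->
    P.-integrable setT (fun w => (f w * Z' w)%:E).
  move=> mZ' Z'Z; apply: le_integrable fZi => //.
    apply/measurable_EFinP; apply: measurable_funM => //.
    exact: sub_measurable_fun sG Gm mZ'.
  by move=> w _; rewrite lee_fin !normrM ler_wpM2l.
have Zpi : P.-integrable setT (fun w => (f w * Z^\+ w)%:E).
  apply: bound => // w; rewrite ger0_norm ?funrpos_ge0//.
  by rewrite /funrpos ge_max normr_ge0 ler_norm.
have Zni : P.-integrable setT (fun w => (f w * Z^\- w)%:E).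
  apply: bound => // w; rewrite ger0_norm ?funrneg_ge0//.
  by rewrite /funrneg ge_max normr_ge0 -normrN ler_norm.
rewrite (@eq_Rintegral _ _ _ _ _ (fun w => f w * Z^\+ w - f w * Z^\- w)).
  rewrite RintegralB// /Rintegral.
  rewrite (integral_mul_ge0_eq0 sG)// ?(integral_mul_ge0_eq0 sG)//= subrr//.
by move=> w _; rewrite -mulrBr -[in LHS](funrposBneg Z).
Qed.

End real_random_variables.

(** * Deterministic inequalities for the proximal step *)

Section euclidean_geometry.
Context {R : realType} {n : nat}.
Local Notation V := 'rV[R]_n.
Implicit Types (u v w : V) (r : V -> \bar R).

Lemma dotvC u v : dotv u v = dotv v u.
Proof. by apply: eq_bigr => i _; rewrite mulrC. Qed.

Lemma dotvDl u v w : dotv (u + v) w = dotv u w + dotv v w.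
Proof. by rewrite -big_split; apply: eq_bigr => i _; rewrite mxE mulrDl. Qed.

Lemma dotvNl u v : dotv (- u) v = - dotv u v.
Proof. by rewrite -sumrN; apply: eq_bigr => i _; rewrite mxE mulNr. Qed.

Lemma dotvZl a u v : dotv (a *: u) v = a * dotv u v.
Proof. by rewrite mulr_sumr; apply: eq_bigr => i _; rewrite mxE mulrA. Qed.

Lemma dotvDr u v w : dotv w (u + v) = dotv w u + dotv w v.
Proof. by rewrite dotvC dotvDl !(dotvC w). Qed.

Lemma dotvNr u v : dotv v (- u) = - dotv v u.
Proof. by rewrite dotvC dotvNl dotvC. Qed.

Lemma dotvZr a u v : dotv v (a *: u) = a * dotv v u.
Proof. by rewrite dotvC dotvZl dotvC. Qed.

Definition dotvE := (dotvDl, dotvDr, dotvNl, dotvNr, dotvZl, dotvZr).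

Lemma dotv0l v : dotv 0 v = 0.
Proof. by rewrite -(scale0r (0 : V)) dotvZl mul0r. Qed.

Lemma dotv0r v : dotv v 0 = 0.
Proof. by rewrite dotvC dotv0l. Qed.

Lemma dotvB_chain u v w z : dotv (u - v) z + dotv (v - w) z = dotv (u - w) z.
Proof. by rewrite -dotvDl addrA subrK. Qed.

Lemma dotv_suml (I : Type) (s : seq I) (f : I -> V) v :
  dotv (\sum_(i <- s) f i) v = \sum_(i <- s) dotv (f i) v.
Proof.
elim: s => [|i s IH]; last by rewrite !big_cons dotvDl IH.
by rewrite !big_nil dotv0l.
Qed.

Lemma dotv_ge0 u : 0 <= dotv u u.
Proof. by apply: sumr_ge0 => i _; rewrite -expr2 sqr_ge0. Qed.

Lemma sqr_enorm u : enorm u ^+ 2 = dotv u u.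
Proof. by rewrite sqr_sqrtr ?dotv_ge0. Qed.

Lemma enorm_ge0 u : 0 <= enorm u.
Proof. exact: sqrtr_ge0. Qed.

Lemma dotv_opp u v : dotv (u - v) (u - v) = dotv (v - u) (v - u).
Proof. by rewrite -opprB dotvNl dotvNr opprK. Qed.

(** Expansion of [|u - c v|^2 >= 0]. The sign of [c] is free, so [c] and [- c] together bound the
    absolute value of the inner product. *)
Lemma young_dotv (c : R) u v :
  2 * c * dotv u v <= dotv u u + c ^+ 2 * dotv v v.
Proof.
have := dotv_ge0 (u - c *: v); rewrite !dotvE (dotvC v u).
by move=> ?; lra.
Qed.

Lemma proper_fin_numP r u : proper_fun r -> r u \is a fin_num <-> r u != +oo%E.
Proof. by move=> [r_ninfty _]; rewrite fin_numE r_ninfty. Qed.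

Lemma convex_efun_fin r u v (t : R) : convex_efun r ->
  r u \is a fin_num -> r v \is a fin_num -> 0 <= t <= 1 ->
  (r (t *: u + (1 - t) *: v)%R <= (t * fine (r u) + (1 - t) * fine (r v))%:E)%E.
Proof.
move=> cr fu fv t01; apply: (le_trans (cr u v t t01)).
by rewrite [leRHS]EFinD !EFinM !fineK.
Qed.

Lemma convex_efun_mean r (y : nat -> V) (K : nat) :
  convex_efun r -> (forall x, r x != -oo%E) -> (forall k, r (y k) \is a fin_num) ->
  (r (K.+1%:R^-1 *: \sum_(k < K.+1) y k)%R
    <= (K.+1%:R^-1 * \sum_(k < K.+1) fine (r (y k)))%:E)%E.
Proof.
move=> cr rNy fy; elim: K => [|K IH].
  by rewrite !big_ord1 invr1 scale1r mul1r fineK.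
have K1 : (K.+1%:R : R) != 0 by rewrite pnatr_eq0.
have K2 : (K.+2%:R : R) != 0 by rewrite pnatr_eq0.
(* The mean of [K.+2] points puts weight [t] on the mean of the first [K.+1] and [1 - t] on the
   last. *)
pose t : R := K.+1%:R / K.+2%:R.
have t01 : 0 <= t <= 1.
  by rewrite divr_ge0//= ler_pdivrMr ?ltr0n// mul1r ler_nat.
have t1 : 1 - t = K.+2%:R^-1.
  by apply: (mulIf K2); rewrite mulrBl divfK// mulVf// mul1r -natr1 addrAC subrr add0r.
have tK : K.+2%:R^-1 = t * K.+1%:R^-1 by rewrite /t mulrAC divff// mul1r.
(* The induction hypothesis bounds [r] at the previous mean by a real number, which excludes
   [+oo]. *)
have fK : r (K.+1%:R^-1 *: \sum_(k < K.+1) y k) \is a fin_num.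
  by rewrite fin_numE rNy/=; apply/eqP => ry; move: IH; rewrite ry.
rewrite !(big_ord_recr K.+1)/= scalerDr mulrDr -[in X in r (_ + X)]t1.
rewrite {1 2}tK -scalerA; apply: (le_trans (convex_efun_fin cr fK _ t01)) => //.
rewrite lee_fin t1 lerD2r -[leRHS]mulrA ler_wpM2l//; first by case/andP: t01.
by rewrite -lee_fin fineK.
Qed.

Lemma is_prox_fin_num (gamma : R) r y p : proper_fun r ->
  is_prox gamma r y p -> r p \is a fin_num.
Proof.
move=> pr [_ pmin]; apply/proper_fin_numP => //; apply/eqP => rp.
have [u ru] := pr.2; have := pmin u I; rewrite /= rp addye// leye_eq.
move/proper_fin_numP : ru => /(_ pr) /fineK <-.
by rewrite -EFinD.
Qed.

(** First-order optimality: [p] is compared with the points [t u + (1 - t) p] of the segment towards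
    [u], and the inequality is divided by [t]. *)
Lemma is_prox_variational (gamma : R) r y p u : proper_fun r -> convex_efun r ->
  0 < gamma -> is_prox gamma r y p -> r u \is a fin_num ->
  gamma * (fine (r p) - fine (r u)) <= dotv (p - y) (u - p).
Proof.
move=> pr cr g0 prox fu; have fp := is_prox_fin_num pr prox.
have g20 : 0 < 2 * gamma by lra.
have H (t : R) : 0 < t -> t <= 1 ->
    2 * gamma * (fine (r p) - fine (r u)) <=
    2 * dotv (p - y) (u - p) + t * dotv (u - p) (u - p).
  move=> t0 t1.
  have := prox.2 (t *: u + (1 - t) *: p) I.
  have t01 : 0 <= t <= 1 by rewrite t1 ltW.
  move=> /le_trans /(_ (leeD2r _ (convex_efun_fin cr fu fp t01))).
  rewrite -{1}(fineK fp) -!EFinD lee_fin !sqr_enorm.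
  have -> : t *: u + (1 - t) *: p - y = (p - y) + t *: (u - p).
    by apply/rowP => i; rewrite !mxE; ring.
  move: (p - y) (u - p) => a b; rewrite !dotvE (dotvC b a).
  rewrite -(ler_pM2l g20) !mulrDr ![2 * gamma * (_ / _)]mulrCA divff ?gt_eqF//.
  move=> ?; rewrite -(ler_pM2l t0); lra.
have b0 := dotv_ge0 (u - p); set b := dotv (u - p) (u - p) in H b0.
rewrite -subr_ge0; set e := _ - _.
have {}H (t : R) : 0 < t -> t <= 1 -> 0 <= 2 * e + t * b.
  by move=> t0 t1; have := H t t0 t1; rewrite /e; lra.
(* This replaces the limit [t -> 0]: if [e < 0], then [2 e + t b] is negative at [t = - e / b] when
   that is at most 1, and at [t = 1] otherwise. *)
rewrite leNgt; apply/negP => e0.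
have [eb|be] := leP (- e) b.
  have bp : 0 < b by lra.
  have := H (- e / b); rewrite divfK ?gt_eqF// divr_gt0 ?oppr_gt0//.
  by rewrite ler_pdivrMr// mul1r => /(_ isT eb); lra.
by have := H 1 ltr01 (lexx _); lra.
Qed.

(** The three-point identity rewrites [2 <p - x, u - p>] as a difference of squared distances. *)
Lemma is_prox_step (gamma : R) r x g p u : proper_fun r -> convex_efun r ->
  0 < gamma -> is_prox gamma r (x - gamma *: g) p -> r u \is a fin_num ->
  2 * gamma * (fine (r p) - fine (r u)) <=
    dotv (x - u) (x - u) - dotv (p - u) (p - u) - dotv (p - x) (p - x)
    + 2 * gamma * dotv g (u - p).
Proof.
move=> pr cr g0 prox fu; have := is_prox_variational pr cr g0 prox fu.
rewrite !dotvE (dotvC u x) (dotvC p x) (dotvC p u).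
by move=> ?; lra.
Qed.

Lemma vi_solutions_fin_num (F : V -> V) r xs : proper_fun r ->
  vi_solutions F r xs -> r xs \is a fin_num.
Proof.
move=> pr sol; apply/proper_fin_numP => //; apply/eqP => rxs.
by have [u ru] := pr.2; have := sol u; rewrite rxs /= addeNy.
Qed.

Lemma vi_solutionsP (F : V -> V) r xs u : proper_fun r ->
  vi_solutions F r xs -> r u \is a fin_num ->
  0 <= dotv (F xs) (u - xs) + fine (r u) - fine (r xs).
Proof.
move=> pr sol fu; have := sol u.
rewrite -(fineK fu) -(fineK (vi_solutions_fin_num pr sol)).
by rewrite -!EFinD lee_fin.
Qed.

(** The prox inequality tested at [xs] and the variational inequality tested at [p] are added, which
    cancels the values of [r]. Young's inequality on [<g - F xs, x - p>] is then absorbed by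
    [- |p - x|^2]. *)
Lemma prox_descent (gamma : R) (F : V -> V) r x g p xs :
  proper_fun r -> convex_efun r -> 0 < gamma ->
  is_prox gamma r (x - gamma *: g) p -> vi_solutions F r xs ->
  dotv (p - xs) (p - xs) <= dotv (x - xs) (x - xs)
    - 2 * gamma * dotv (g - F xs) (x - xs)
    + gamma ^+ 2 * dotv (g - F xs) (g - F xs).
Proof.
move=> pr cr g0 prox sol.
have fp := is_prox_fin_num pr prox.
have := is_prox_step pr cr g0 prox (vi_solutions_fin_num pr sol).
have : 0 <= gamma * (dotv (F xs) (p - xs) + fine (r p) - fine (r xs)).
  by rewrite mulr_ge0 ?(ltW g0)// (vi_solutionsP pr sol).
have := young_dotv gamma (x - p) (g - F xs).
rewrite !dotvE (dotvC p x) (dotvC xs x) (dotvC xs p) (dotvC x g)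
  (dotvC x (F xs)) (dotvC p g) (dotvC p (F xs)) (dotvC (F xs) g).
by move=> ? ? ?; lra.
Qed.

End euclidean_geometry.

(** * Pathwise bound on the gap of the averaged iterate *)

Section pathwise_bounds.
Context {R : realType} {n : nat}.
Local Notation V := 'rV[R]_n.
Implicit Types (F : V -> V) (r : V -> \bar R) (Xs C : set V).

Lemma proj_onP Xs x : proj_well_defined Xs -> nearest Xs x (proj_on Xs x).
Proof. by move=> pw; have [y [ny _]] := pw x; apply: getPex; exists y. Qed.

Lemma proj_on_in Xs x : proj_well_defined Xs -> Xs (proj_on Xs x).
Proof. by move=> /(proj_onP x) -[]. Qed.

Lemma proj_on_le Xs x y : proj_well_defined Xs -> Xs y ->
  dotv (x - proj_on Xs x) (x - proj_on Xs x) <= dotv (x - y) (x - y).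
Proof.
move=> /(proj_onP x) [_ +] Xy => /(_ _ Xy).
rewrite lee_fin -!sqr_enorm -(ler_pXn2r (ltn0Sn 1)) ?nnegrE ?enorm_ge0//.
by rewrite !sqr_enorm ![dotv (x - _) _]dotv_opp.
Qed.

(** Young's inequality with [c = l] plays the part of Cauchy-Schwarz: [2 l <a, b> <= |a|^2 + l^2
    |b|^2 <= l <a, b> + l^2 |b|^2]. *)
Lemma star_cocoercive_le F Xs (l : R) x : 0 < l -> star_cocoercive F Xs l ->
  let N := dotv (x - proj_on Xs x) (x - proj_on Xs x) in
  dotv (F x - F (proj_on Xs x)) (x - proj_on Xs x) <= l * N /\
  dotv (F x - F (proj_on Xs x)) (F x - F (proj_on Xs x)) <= l ^+ 2 * N.
Proof.
move=> l0 /(_ x); rewrite sqr_enorm /=; move: (F x - _) (x - _) => a b ab.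
have := young_dotv l a b => Y.
have ab2 : dotv a b <= l * dotv b b by rewrite -(ler_pM2l l0); lra.
by split=> //; apply: (le_trans ab); rewrite expr2 -mulrA ler_pM2l.
Qed.

(** The vector [gs] splits [g] by [|g|^2 <= 2 |g - gs|^2 + 2 |gs|^2], which is [|g - 2 gs|^2 >= 0].
    The point [a] splits the error term along [u - x = (u - a) - (x - a)], so that [u] is paired
    with the error only in the last summand. *)
Lemma sgda_step_le (gamma : R) F r x g p u gs a :
  proper_fun r -> convex_efun r -> 0 < gamma -> monotone_op F ->
  is_prox gamma r (x - gamma *: g) p -> r u \is a fin_num ->
  2 * gamma * (dotv (F u) (p - u) + fine (r p) - fine (r u)) <=
  dotv (x - u) (x - u) - dotv (p - u) (p - u)
  + (2 * gamma ^+ 2 * dotv (g - gs) (g - gs) + 2 * gamma ^+ 2 * dotv gs gs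
     - 2 * gamma * dotv (g - F x) (x - a))
  + 2 * gamma * dotv (F u) (p - x) + 2 * gamma * dotv (g - F x) (u - a).
Proof.
move=> pr cr g0 mF prox fu.
have := is_prox_step pr cr g0 prox fu.
have : 0 <= gamma * dotv (F x - F u) (x - u) by rewrite mulr_ge0 ?(ltW g0).
have := young_dotv gamma (x - p) g.
have := dotv_ge0 (gamma *: (g - gs - gs)).
move: (F x) (F u) => fx fv.
rewrite !dotvE (dotvC u x) (dotvC p x) (dotvC u p) (dotvC x g) (dotvC p g).
rewrite (dotvC gs g).
by move=> ? ? ? ?; lra.
Qed.

Lemma sgda_sum_le (gamma : R) F r Xs (x g : nat -> V) u (K : nat) :
  proper_fun r -> convex_efun r -> 0 < gamma -> monotone_op F ->
  (forall k, is_prox gamma r (x k - gamma *: g k) (x k.+1)) ->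
  r u \is a fin_num ->
  2 * gamma * \sum_(k < K)
    (dotv (F u) (x k.+1 - u) + fine (r (x k.+1)) - fine (r u)) <=
  dotv (x 0%N - u) (x 0%N - u) - dotv (x K - u) (x K - u)
  + \sum_(k < K)
    (2 * gamma ^+ 2 * dotv (g k - F (proj_on Xs (x k))) (g k - F (proj_on Xs (x k)))
     + 2 * gamma ^+ 2 * dotv (F (proj_on Xs (x k))) (F (proj_on Xs (x k)))
     - 2 * gamma * dotv (g k - F (x k)) (x k - x 0%N))
  + 2 * gamma * dotv (F u) (x K - x 0%N)
  + 2 * gamma * dotv (\sum_(k < K) (g k - F (x k))) (u - x 0%N).
Proof.
move=> pr cr g0 mF prox fu; elim: K => [|K IH].
  by rewrite !big_ord0 !subrr dotv0l dotv0r !mulr0 !addr0.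
rewrite !big_ord_recr/= (dotvDl (\sum_(k < K) _)).
have := sgda_step_le (F (proj_on Xs (x K))) (x 0%N) pr cr g0 mF (prox K) fu.
have -> : dotv (F u) (x K.+1 - x 0%N) =
    dotv (F u) (x K - x 0%N) + dotv (F u) (x K.+1 - x K).
  by rewrite -dotvDr; congr dotv; apply/rowP => i; rewrite !mxE; ring.
by move=> ?; lra.
Qed.

(** Any solution in [C] contributes a nonnegative value to the supremum. This sign allows
    [ge0_integral_mono] to be applied to the gap. *)
Lemma gap_ge0 F r Xs C z : proper_fun r -> Xs = vi_solutions F r ->
  Xs !=set0 -> Xs `<=` C -> (0 <= gap F r C z)%E.
Proof.
move=> pr -> [xs sol] XC; apply: (le_trans (sol z)).
by apply: ereal_sup_ubound; exists xs => //; exact: XC.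
Qed.

(** The coefficient [5 / 2] is [1 + 1 / 2 + 1]: the initial distance, Young for [<F u, u - x_0>],
    and Young for the summed errors. The term with factor 6 is [3 gamma^2 |F u|^2] with
    [|F u|^2 <= 2 (M + l^2 O)]. *)
Lemma gap_mean_le (gamma l S M O : R) F r Xs C (x g : nat -> V) (K : nat) :
  proper_fun r -> convex_efun r -> 0 < gamma -> monotone_op F ->
  proj_well_defined Xs -> 0 < l -> star_cocoercive F Xs l -> Xs `<=` C ->
  (forall k, is_prox gamma r (x k - gamma *: g k) (x k.+1)) ->
  (forall u, C u -> dotv (x 0%N - u) (x 0%N - u) <= S) ->
  (forall xs, Xs xs -> dotv (F xs) (F xs) <= M) ->
  (forall u v, C u -> C v -> dotv (u - v) (u - v) <= O) ->
  (1 <= K)%N ->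
  (gap F r C (K%:R^-1 *: \sum_(1 <= k < K.+1) x k)%R <=
   ((2 * gamma * K%:R)^-1 *
    (5 / 2 * S + 6 * gamma ^+ 2 * (M + l ^+ 2 * O) + 2 * gamma ^+ 2 * K%:R * M
     + (2 * gamma ^+ 2 *
        \sum_(k < K) dotv (g k - F (proj_on Xs (x k))) (g k - F (proj_on Xs (x k)))
        - 2 * gamma * \sum_(k < K) dotv (g k - F (x k)) (x k - x 0%N)
        + gamma ^+ 2 * dotv (\sum_(k < K) (g k - F (x k)))
                            (\sum_(k < K) (g k - F (x k))))))%:E)%E.
Proof.
move=> pr cr g0 mF pw l0 lF XC prox CS XM CO.
case: K => // K _; rewrite big_add1 big_mkord /=.
have K0 : (0 : R) < K.+1%:R by rewrite ltr0n.
have fx k : r (x k.+1) \is a fin_num by exact: is_prox_fin_num (prox k).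
have rz := convex_efun_mean K cr pr.1 fx.
set z := (X in r X) in rz.
have fz : r z \is a fin_num.
  by rewrite fin_numE pr.1/=; apply/eqP => ry; move: rz; rewrite ry.
apply: ge_ereal_sup => _ [u Cu <-].
have [ru|fu] := eqVneq (r u) +oo%E.
  by rewrite ru addeNy leNye.
move/(proper_fin_numP _ pr) in fu.
rewrite -(fineK fz) in rz *; rewrite -(fineK fu) -!EFinD !lee_fin in rz *.
have g2K : 0 < 2 * gamma * K.+1%:R by rewrite !mulr_gt0.
rewrite -(ler_pM2l g2K) [leRHS]mulrA divff ?gt_eqF// mul1r.
have := @sgda_sum_le gamma F r Xs x g u K.+1 pr cr g0 mF prox fu.
(* With [c = gamma] the square [|x_{K+1} - u|^2] is absorbed by the telescoped sum; with
   [c = 2 gamma] the next line costs only half of [|u - x_0|^2]. *)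
have := young_dotv gamma (x K.+1 - u) (F u).
have := young_dotv (2 * gamma) (u - x 0%N) (F u).
have := CS u Cu.
have Y := young_dotv gamma (u - x 0%N) (\sum_(k < K.+1) (g k - F (x k))).
(* The projection of [u] lies in [Xs], hence in [C]: [M] bounds [F] there, and [O] bounds its
   squared distance to [u]. *)
have Fu : dotv (F u) (F u) <= 2 * M + 2 * (l ^+ 2 * O).
  have := XM _ (proj_on_in u pw).
  have [_] := star_cocoercive_le u l0 lF.
  have := CO u _ Cu (XC _ (proj_on_in u pw)).
  rewrite -(ler_pM2l (exprn_gt0 2 l0)).
  have := dotv_ge0 (F u - F (proj_on Xs u) - F (proj_on Xs u)).
  move: (F u) (F (proj_on Xs u)) => a b.
  rewrite !dotvE (dotvC b a); move=> ? ? ? ?; lra.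
have {Fu} : gamma ^+ 2 * dotv (F u) (F u) <= gamma ^+ 2 * (2 * M + 2 * (l ^+ 2 * O)).
  by rewrite ler_wpM2l ?sqr_ge0.
have -> : dotv (F u) (x K.+1 - x 0%N) = dotv (x K.+1 - u) (F u) + dotv (u - x 0%N) (F u).
  by rewrite dotvC -dotvDl; congr dotv; apply/rowP => i; rewrite !mxE; ring.
rewrite [dotv (x 0%N - u) _]dotv_opp (dotvC (\sum_(k < _) _) (u - _)).
(* Apart from [r], the summand is affine in the iterate, so its sum is [K.+1] times its value at the
   mean [z]; the values of [r] are handled by Jensen through [rz]. *)
have -> : \sum_(k < K.+1) (dotv (F u) (x k.+1 - u) + fine (r (x k.+1)) - fine (r u))
   = K.+1%:R * (dotv (F u) (z - u) - fine (r u)) + \sum_(k < K.+1) fine (r (x k.+1)).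
  have -> : dotv (F u) (z - u) =
      K.+1%:R^-1 * \sum_(k < K.+1) dotv (x k.+1) (F u) - dotv (F u) u.
    by rewrite dotvDr dotvNr (dotvC _ z) dotvZl dotv_suml.
  rewrite (eq_bigr (fun k : 'I_K.+1 => dotv (x k.+1) (F u) + fine (r (x k.+1))
      - (dotv (F u) u + fine (r u)))); last first.
    by move=> k _; rewrite dotvDr dotvNr (dotvC (F u) (x _)); ring.
  rewrite sumrB big_split/= sumr_const card_ord -mulr_natl.
  by field; rewrite gt_eqF.
have : \sum_(k < K.+1) (2 * gamma ^+ 2 * dotv (F (proj_on Xs (x k))) (F (proj_on Xs (x k))))
   <= 2 * gamma ^+ 2 * K.+1%:R * M.
  apply: (@le_trans _ _ (\sum_(k < K.+1) (2 * gamma ^+ 2 * M))).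
    apply: ler_sum => k _; rewrite ler_wpM2l ?mulr_ge0 ?(ltW g0)//.
    exact: (XM _ (proj_on_in (x k) pw)).
  by rewrite sumr_const card_ord -[_ *+ K.+1]mulr_natr mulrAC.
rewrite [in X in _ -> X]big_split/= big_split/= sumrN -!mulr_sumr.
have : K.+1%:R * fine (r z) <= \sum_(k < K.+1) fine (r (x k.+1)).
  by rewrite -ler_pdivlMl.
move=> H; have := ler_wpM2l (ltW g0) H.
move=> *; lra.
Qed.

End pathwise_bounds.

(** * Square-integrable random vectors *)

Section square_integrable.
Context {d : measure_display} {T : measurableType d} {R : realType} {n : nat}.
Context (P : probability T R).
Local Notation V := 'rV[R]_n.
Implicit Types (u v : T -> V) (G : set (set T)).

Lemma Rintegral_sum (I : Type) (s : seq I) (f : I -> T -> R) :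
  (forall i, P.-integrable setT (EFin \o f i)) ->
  \int[P]_w (\sum_(i <- s) f i w) = \sum_(i <- s) \int[P]_w f i w.
Proof.
move=> fi; rewrite /Rintegral.
under eq_integral do rewrite -sumEFin.
rewrite integral_sum// -sum_fine// => i _.
exact: integrable_fin_num (fi i).
Qed.

Lemma integrable_sumr (I : Type) (s : seq I) (f : I -> T -> R) :
  (forall i, P.-integrable setT (EFin \o f i)) ->
  P.-integrable setT (EFin \o (fun w => \sum_(i <- s) f i w)).
Proof.
move=> fi; have := integrable_sum measurableT s (P := xpredT) (fun i _ => fi i).
by apply: eq_integrable => // w _; rewrite /= sumEFin.
Qed.

(* Needed for [gap], which may fail to be measurable: the integral of a
   nonnegative function is a supremum over the simple functions below it. *)
Lemma ge0_integral_mono (f h : T -> \bar R) :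
  (forall w, 0 <= f w)%E -> (forall w, f w <= h w)%E ->
  (\int[P]_w f w <= \int[P]_w h w)%E.
Proof.
move=> f0 fh; have h0 w : (0 <= h w)%E := le_trans (f0 w) (fh w).
rewrite !ge0_integralTE//; apply: le_ereal_sup => _ [s sf <-].
by exists s => // w; exact: le_trans (sf w) (fh w).
Qed.

(** Integrating over the whole space, a member of [G], gives [E X = E Y <= E Y^\+ <= E W]; the last
    step uses [Y <= W] almost surely and [0 <= W]. *)
Lemma cond_exp_le_Rintegral G (X W : T -> R) :
  sigma_algebra setT G -> G `<=` measurable -> measurable_fun setT X ->
  (forall w, 0 <= X w) -> (forall w, 0 <= W w) ->
  P.-integrable setT (EFin \o W) -> cond_exp_le P G X W ->
  P.-integrable setT (EFin \o X) /\ \int[P]_w X w <= \int[P]_w W w.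
Proof.
move=> sG Gm mX X0 W0 Wi [Y [[mY YX] YW]].
have mY' : measurable_fun setT Y by exact: sub_measurable_fun sG Gm mY.
have GT : G setT by have [s0 sC _] := sG; have := sC _ s0; rewrite setD0.
have mW := measurable_int P Wi.
have XW : (\int[P]_w (X w)%:E <= \int[P]_w (W w)%:E)%E.
  rewrite -(YX _ GT) integralE.
  have n0 : (0 <= \int[P]_w Y^\- w)%E by apply: integral_ge0.
  apply: (@le_trans _ _ (\int[P]_w Y^\+ w)%E).
    by rewrite -[leRHS]adde0 leeD2l// oppe_le0.
  apply: ae_ge0_le_integral => //.
  - exact: measurable_funepos.
  - by move=> w _; rewrite lee_fin.
  - apply: filterS YW => w YW _; rewrite funeposE ge_max YW.
    by rewrite lee_fin W0.
have Xi : P.-integrable setT (EFin \o X).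
  apply/integrableP; split; first exact/measurable_EFinP.
  under eq_integral do rewrite /= ger0_norm//.
  by apply: (le_lt_trans XW); rewrite ltey_eq (integrable_fin_num _ Wi).
split=> //; rewrite /Rintegral fine_le// ?(integrable_fin_num _ Wi)//.
exact: (integrable_fin_num _ Xi).
Qed.

Definition vmeasurable u := forall i, measurable_fun setT (fun w => u w 0 i).

Lemma sub_vmeasurable G u : sigma_algebra setT G -> G `<=` measurable ->
  vmeasurable_wrt G u -> vmeasurable u.
Proof. by move=> sG Gm mu i; exact: sub_measurable_fun sG Gm (mu i). Qed.

Lemma measurable_dotv u v : vmeasurable u -> vmeasurable v ->
  measurable_fun setT (fun w => dotv (u w) (v w)).
Proof. by move=> mu mv; apply: measurable_sum => i; exact: measurable_funM. Qed.

Definition vL2 u :=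
  vmeasurable u /\ P.-integrable setT (fun w => (dotv (u w) (u w))%:E).

Lemma vmeasurable_wrtD G u v : vmeasurable_wrt G u -> vmeasurable_wrt G v ->
  vmeasurable_wrt G (fun w => u w + v w).
Proof.
move=> mu mv i.
have -> : (fun w => (u w + v w) 0 i) = (fun w => u w 0 i) \+ (fun w => v w 0 i).
  by apply/funext => w; rewrite mxE.
exact: measurable_funD (mu i) (mv i).
Qed.

Lemma vmeasurable_wrtB G u v : vmeasurable_wrt G u -> vmeasurable_wrt G v ->
  vmeasurable_wrt G (fun w => u w - v w).
Proof.
move=> mu mv i.
have -> : (fun w => (u w - v w) 0 i) = (fun w => u w 0 i) \- (fun w => v w 0 i).
  by apply/funext => w; rewrite !mxE.
exact: measurable_funB (mu i) (mv i).
Qed.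

Lemma vmeasurable_wrt_cst G (a : V) : vmeasurable_wrt G (fun=> a).
Proof. by move=> i; exact: measurable_cst. Qed.

Lemma vmeasurableD u v : vmeasurable u -> vmeasurable v ->
  vmeasurable (fun w => u w + v w).
Proof.
move=> mu mv i; under eq_fun do rewrite mxE.
exact: measurable_funD.
Qed.

Lemma vmeasurableB u v : vmeasurable u -> vmeasurable v ->
  vmeasurable (fun w => u w - v w).
Proof.
move=> mu mv i; under eq_fun do rewrite !mxE.
exact: measurable_funB.
Qed.

Lemma vL2_le u (f : T -> R) : vmeasurable u ->
  P.-integrable setT (EFin \o f) -> (forall w, dotv (u w) (u w) <= f w) -> vL2 u.
Proof.
move=> mu fi uf; split=> //; apply: le_integrable fi => //.
  by apply/measurable_EFinP; exact: measurable_dotv.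
move=> w _; rewrite lee_fin ger0_norm ?dotv_ge0//.
by rewrite (le_trans (uf w))// ler_norm.
Qed.

Lemma integrable_dotv u v : vL2 u -> vL2 v ->
  P.-integrable setT (fun w => (dotv (u w) (v w))%:E).
Proof.
move=> [mu ui] [mv vi]; apply: le_integrable (integrableD measurableT ui vi) => //.
  by apply/measurable_EFinP; exact: measurable_dotv.
move=> w _; rewrite /= lee_fin [leRHS]ger0_norm ?addr_ge0 ?dotv_ge0//.
have u0 := dotv_ge0 (u w); have v0 := dotv_ge0 (v w).
have := young_dotv 1 (u w) (v w); have := young_dotv (- 1) (u w) (v w).
by rewrite ler_norml => ? ?; apply/andP; split; lra.
Qed.

Lemma vL2D u v : vL2 u -> vL2 v -> vL2 (fun w => u w + v w).
Proof.
move=> u2 v2; have [mu ui] := u2; have [mv vi] := v2.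
split; first exact: vmeasurableD.
have -> : (fun w => (dotv (u w + v w) (u w + v w))%:E) =
    (fun w => (dotv (u w) (u w))%:E + (dotv (u w) (v w))%:E +
     ((dotv (u w) (v w))%:E + (dotv (v w) (v w))%:E))%E.
  by apply/funext => w; rewrite !dotvE (dotvC (v w)) -!EFinD addrA.
by do 2 ?[apply: integrableD => //]; exact: integrable_dotv.
Qed.

Lemma vL2B u v : vL2 u -> vL2 v -> vL2 (fun w => u w - v w).
Proof.
move=> u2 [mv vi]; apply: vL2D => //; split.
  move=> i; under eq_fun do rewrite mxE.
  by apply: measurableT_comp => //; exact: (mv i).
by under eq_fun do rewrite dotvNl dotvNr opprK.
Qed.

Lemma Rintegral_pythagoras u v : vL2 u -> vL2 v ->
  \int[P]_w dotv (u w) (v w) = 0 ->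
  \int[P]_w dotv (u w + v w) (u w + v w) =
  \int[P]_w dotv (u w) (u w) + \int[P]_w dotv (v w) (v w).
Proof.
move=> u2 v2 uv0; have iuv := integrable_dotv u2 v2.
have i2 : P.-integrable setT (EFin \o (fun w => 2 * dotv (u w) (v w))).
  exact: (integrableZl measurableT 2 iuv).
rewrite (@eq_Rintegral _ _ _ _ _ (fun w =>
    dotv (u w) (u w) + dotv (v w) (v w) + 2 * dotv (u w) (v w))); last first.
  by move=> w _; rewrite !dotvE (dotvC (v w)); ring.
rewrite (RintegralD measurableT (integrableD measurableT u2.2 v2.2) i2).
rewrite (RintegralZl 2 measurableT iuv) uv0 mulr0 addr0.
exact: (RintegralD measurableT u2.2 v2.2).
Qed.

Lemma vL2_coord u v i : vL2 u -> vL2 v ->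
  P.-integrable setT (fun w => (u w 0 i * v w 0 i)%:E).
Proof.
(* Keeping only coordinate [i] of each vector turns the product of coordinates into an inner
   product. *)
have coord (y : T -> V) : vL2 y -> vL2 (fun w => \row_j (y w 0 i *+ (j == i))).
  move=> y2; apply: (vL2_le _ y2.2).
    move=> j; under eq_fun do rewrite mxE.
    case: (j == i); last exact: measurable_cst.
    exact: (y2.1 i).
  move=> w; rewrite {1}/dotv (bigD1 i)//= big1 ?addr0 => [|j /negPf ji].
    rewrite !mxE eqxx /dotv (bigD1 i)//= lerDl sumr_ge0// => j _.
    by rewrite -expr2 sqr_ge0.
  by rewrite !mxE ji mulr0.
move=> /coord u2 /coord v2; apply: eq_integrable (integrable_dotv u2 v2) => // w _.
rewrite /dotv (bigD1 i)//= big1 ?addr0 => [|j /negPf ji].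
  by rewrite !mxE eqxx.
by rewrite !mxE ji mulr0.
Qed.

Lemma vcond_exp_orthogonal G X Y Z :
  sigma_algebra setT G -> G `<=` measurable -> vcond_exp P G X Y ->
  vL2 (fun w => X w - Y w) -> vmeasurable_wrt G Z -> vL2 Z ->
  \int[P]_w dotv (X w - Y w) (Z w) = 0.
Proof.
move=> sG Gm XY D2 mZ Z2; rewrite Rintegral_sum; last first.
  by move=> i; exact: vL2_coord.
(* Pairing with the constant vector 1 makes the coordinates of [X - Y] integrable; those of [Y]
   follow by subtraction from [X]. *)
have one2 : vL2 (fun=> const_mx 1 : V).
  split; first by move=> i; exact: measurable_cst.
  exact: finite_measure_integrable_cst.
apply: big1 => i _; have [Xi [mY YX]] := XY i.
have Di : P.-integrable setT (fun w => ((X w - Y w) 0 i)%:E).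
  apply: eq_integrable (vL2_coord i D2 one2) => // w _.
  by rewrite [const_mx _ _ _]mxE mulr1.
have Yi : P.-integrable setT (fun w => (Y w 0 i)%:E).
  apply: eq_integrable (integrableB measurableT Xi Di) => // w _.
  by rewrite /= -EFinB !mxE opprB addrC subrK.
apply: (integral_mul_eq0 sG Gm Di _ (mZ i)); last exact: vL2_coord.
move=> A GA; have mA := Gm _ GA.
have -> : (\int[P]_(w in A) ((X w - Y w) 0 i)%:E =
    \int[P]_(w in A) ((X w 0 i)%:E - (Y w 0 i)%:E))%E.
  by apply: eq_integral => w _; rewrite !mxE.
rewrite integralB//; try exact: integrableS (@subsetT _ A) _.
by rewrite (YX _ GA) subee// integrable_fin_num//; exact: integrableS Xi.
Qed.

End square_integrable.

(** * Moments of the SGDA iterates *)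

Section lyapunov_recursion.
Context {R : realType}.
(** These stand for the expectations of [|x_k - xs_k|^2], [<F x_k - F xs_k, x_k - xs_k>],
    [sigma_k^2] and [|g_k - F xs_k|^2], where [xs_k] is the projection of [x_k]. Here [b] is
    [B / rho], so [B] appears as [b * rho]. *)
Context (eN eW eS eQ : nat -> R) (gamma A b C D1 D2 rho : R).
Context (eN0 : forall k, 0 <= eN k) (eW0 : forall k, 0 <= eW k)
  (eS0 : forall k, 0 <= eS k) (gamma0 : 0 < gamma) (b0 : 0 <= b).
Context (stepsize : gamma * (2 * (A + b * C)) <= 1).
Context (descent : forall k,
  eN k.+1 <= eN k - 2 * gamma * eW k + gamma ^+ 2 * eQ k).
Context (second_moment : forall k,
  eQ k <= 2 * A * eW k + b * rho * eS k + D1).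
Context (variance_reduction : forall k,
  eS k.+1 <= 2 * C * eW k + (1 - rho) * eS k + D2).

(* Lyapunov function E|x_k - x*_k|^2 + (B / rho) gamma^2 E sigma_k^2. *)
Let sum_eW_le K : gamma * \sum_(k < K) eW k <=
  eN 0%N + b * gamma ^+ 2 * eS 0%N + K%:R * gamma ^+ 2 * (D1 + b * D2).
Proof.
suff H : eN K + b * gamma ^+ 2 * eS K + gamma * \sum_(k < K) eW k <=
  eN 0%N + b * gamma ^+ 2 * eS 0%N + K%:R * gamma ^+ 2 * (D1 + b * D2).
  apply: le_trans H; rewrite lerDr addr_ge0// ?mulr_ge0// ?ltW//.
elim: K => [|K IH]; first by rewrite big_ord0 mulr0 !mul0r.
rewrite big_ord_recr/= mulrDr -natr1.
(* The stepsize bound keeps [- gamma eW] out of [- 2 gamma eW]. The [eS] terms recombine exactly,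
   since [b rho + b (1 - rho) = b]. *)
have H1 : 0 <= gamma * eW K * (1 - gamma * (2 * (A + b * C))).
  by rewrite !mulr_ge0 ?subr_ge0// ltW.
have H2 := ler_wpM2l (sqr_ge0 gamma) (second_moment K).
have H3 := ler_wpM2l (mulr_ge0 b0 (sqr_ge0 gamma)) (variance_reduction K).
have := descent K => H4.
by lra.
Qed.

(** Adding [b] times the variance recursion to the second-moment bound makes the [eS] terms
    telescope. *)
Lemma sum_eQ_le K : \sum_(k < K) eQ k <=
  2 * (A + b * C) * \sum_(k < K) eW k + b * eS 0%N + K%:R * (D1 + b * D2).
Proof.
suff H : b * eS K + \sum_(k < K) eQ k <=
  2 * (A + b * C) * \sum_(k < K) eW k + b * eS 0%N + K%:R * (D1 + b * D2).
  by apply: le_trans H; rewrite lerDr mulr_ge0.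
elim: K => [|K IH]; first by rewrite !big_ord0; lra.
rewrite !big_ord_recr/= -natr1.
have H2 := second_moment K.
have H3 := ler_wpM2l b0 (variance_reduction K).
by lra.
Qed.

(** The factor [3 / 2 * gamma] is [3 gamma^2] divided by the [2 gamma] of the gap bound. The two
    sums give [3 (A + b C)] in place of [M]; the facts [P1] to [P7] are the slack, with
    [M - 3 (A + b C) = A + l + 5 b C]. *)
Lemma gradient_noise_le (l M : R) K : 0 <= A -> 0 <= C -> 0 <= D1 -> 0 <= D2 ->
  0 <= l ->
  M = 4 * A + l + 8 * b * C ->
  3 / 2 * gamma * \sum_(k < K) eQ k <=
  M * eN 0%N + (4 + M * gamma) * (gamma * b * eS 0%N)
  + K%:R * (gamma * (2 + gamma * M) * (D1 + 2 * b * D2)).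
Proof.
move=> A0 C0 D10 D20 l0 ->.
have bC : 0 <= b * C by rewrite mulr_ge0.
have bD : 0 <= b * D2 by rewrite mulr_ge0.
have bS : 0 <= b * eS 0%N by rewrite mulr_ge0.
have g0 := ltW gamma0.
have K0 : (0 : R) <= K%:R by [].
have m0 : 0 <= A + l + 5 * (b * C) by lra.
have M0 : 0 <= 4 * A + l + 8 * (b * C) by lra.
have c0 : 0 <= D1 + b * D2 by lra.
have AC : 0 <= 3 * (A + b * C) by lra.
have H1 := ler_wpM2l AC (sum_eW_le K).
have H2 := ler_wpM2l g0 (sum_eQ_le K).
have P1 : 0 <= (A + l + 5 * (b * C)) * eN 0%N by rewrite mulr_ge0.
have P2 : 0 <= gamma * (b * eS 0%N) by rewrite mulr_ge0.
have P3 : 0 <= gamma * gamma * (b * eS 0%N) * (A + l + 5 * (b * C)).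
  by rewrite !mulr_ge0.
have P4 : 0 <= K%:R * gamma * (D1 + b * D2) by rewrite !mulr_ge0.
have P5 : 0 <= K%:R * gamma * gamma * (A + l + 5 * (b * C)) * (D1 + b * D2).
  by rewrite !mulr_ge0.
have P6 : 0 <= K%:R * gamma * (b * D2) by rewrite !mulr_ge0.
have P7 : 0 <= K%:R * gamma * gamma * (4 * A + l + 8 * (b * C)) * (b * D2).
  by rewrite !mulr_ge0.
lra.
Qed.

End lyapunov_recursion.

(** * Propagation of second moments and the expected gap *)

Section sgda_moments.
Context {d : measure_display} {T : measurableType d} {R : realType} {n : nat}.
Local Notation V := 'rV[R]_n.
Context (P : probability T R) (F : V -> V) (r : V -> \bar R) (Xs : set V).
Context (G : nat -> set (set T)) (x g : nat -> T -> V) (sigma : nat -> T -> R).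
Context (x0 : V) (sigma0 l gamma A B C D1 D2 rho S : R).
Context (r_proper : proper_fun r) (r_convex : convex_efun r).
Context (XsE : Xs = vi_solutions F r) (Xs_proj : proj_well_defined Xs).
Context (F_mono : monotone_op F) (l0 : 0 < l) (F_star : star_cocoercive F Xs l).
Context (A0 : 0 <= A) (B0 : 0 <= B) (C0 : 0 <= C) (D10 : 0 <= D1) (D20 : 0 <= D2).
Context (rho01 : 0 < rho <= 1) (sigmaE : forall w, sigma 0%N w = sigma0).
Context (pa : parametric_assumption P G F Xs x g sigma A B C D1 D2 rho).
Context (gamma0 : 0 < gamma) (x_sgda : sgda gamma r x0 x g).
Context (Xs_bounded : forall u, Xs u -> dotv (x0 - u) (x0 - u) <= S).

Local Notation xs k := (fun w => proj_on Xs (x k w)).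
Local Notation inner k w :=
  (dotv (F (x k w) - F (proj_on Xs (x k w))) (x k w - proj_on Xs (x k w))).

Let G_sigma k : sigma_algebra setT (G k). Proof. by have [] := pa_filtration pa k. Qed.
Let G_meas k : G k `<=` measurable. Proof. by have [] := pa_filtration pa k. Qed.
Let G_incr k : G k `<=` G k.+1. Proof. by have [] := pa_filtration pa k. Qed.

(** Unbiasedness makes [F (x k)] a version of a conditional expectation given [G k], hence
    measurable. *)
Let Fx_wrt k : vmeasurable_wrt (G k) (fun w => F (x k w)).
Proof.
by move=> i; have [_ [mF _]] := pa_unbiased pa k i; apply/measurable_EFinP.
Qed.

Let vmeas k (u : T -> V) : vmeasurable_wrt (G k) u -> vmeasurable u.
Proof. exact: sub_vmeasurable (G_sigma k) (@G_meas k). Qed.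

Let inner_ge0 k w : 0 <= inner k w.
Proof. exact: F_mono. Qed.

Let Rintegral_const (c : R) : \int[P]_w c = c.
Proof. by rewrite Rintegral_cst// -[X in fine X]/(P setT) probability_setT mulr1. Qed.

Let dist2_step k w :
  dotv (x k.+1 w - xs k.+1 w) (x k.+1 w - xs k.+1 w) <=
  dotv (x k w - xs k w) (x k w - xs k w)
  - 2 * gamma * dotv (g k w - F (xs k w)) (x k w - xs k w)
  + gamma ^+ 2 * dotv (g k w - F (xs k w)) (g k w - F (xs k w)).
Proof.
apply: le_trans (prox_descent r_proper r_convex gamma0 (x_sgda.2 k w) _).
  by apply: proj_on_le => //; exact: proj_on_in.
by rewrite -XsE; exact: proj_on_in.
Qed.

(** Star-cocoercivity makes the inner product integrable, hence also the right-hand sides of both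
    conditional bounds, which can then be integrated. The next distance is dominated through
    [dist2_step]. *)
Let moment_step k : vL2 P (fun w => x k w - xs k w) ->
  P.-integrable setT (EFin \o (fun w => sigma k w ^+ 2)) ->
  [/\ vL2 P (fun w => F (x k w) - F (xs k w)),
      vL2 P (fun w => g k w - F (xs k w)) /\
      \int[P]_w dotv (g k w - F (xs k w)) (g k w - F (xs k w)) <=
        2 * A * \int[P]_w inner k w + B * \int[P]_w sigma k w ^+ 2 + D1,
      P.-integrable setT (EFin \o (fun w => sigma k.+1 w ^+ 2)) /\
      \int[P]_w sigma k.+1 w ^+ 2 <=
        2 * C * \int[P]_w inner k w + (1 - rho) * \int[P]_w sigma k w ^+ 2 + D2
    & vL2 P (fun w => x k.+1 w - xs k.+1 w)].
Proof.
move=> x2 s2.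
have mx : vmeasurable (x k) by apply: vmeas; exact: (pa_x pa).
have mxs : vmeasurable (xs k) by apply: vmeas; exact: (pa_xstar pa).
have mgs : vmeasurable (fun w => F (xs k w)) by apply: vmeas; exact: (pa_gstar pa).
have mFx : vmeasurable (fun w => F (x k w)) by apply: vmeas; exact: @Fx_wrt k.
have mg : vmeasurable (g k) by apply: vmeas; exact: (pa_g pa).
have F2 : vL2 P (fun w => F (x k w) - F (xs k w)).
  apply: (@vL2_le _ _ _ _ _ _ (fun w => l ^+ 2 * dotv (x k w - xs k w) (x k w - xs k w))).
  - exact: vmeasurableB.
  - by have := integrableZl measurableT (l ^+ 2) x2.2.
  - by move=> w; have [] := star_cocoercive_le (x k w) l0 F_star.
have W1 : P.-integrable setT (EFin \o (fun w => inner k w)).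
  exact: (integrable_dotv F2 x2).
have affine (a b c : R) : 0 <= a -> 0 <= b -> 0 <= c ->
    [/\ forall w, 0 <= a * inner k w + b * sigma k w ^+ 2 + c,
    P.-integrable setT (EFin \o (fun w => a * inner k w + b * sigma k w ^+ 2 + c))
    & \int[P]_w (a * inner k w + b * sigma k w ^+ 2 + c) =
      a * \int[P]_w inner k w + b * \int[P]_w sigma k w ^+ 2 + c].
  move=> a0 b0 c0.
  have i1 : P.-integrable setT (EFin \o (fun w => a * inner k w)).
    exact: (integrableZl measurableT a W1).
  have i2 : P.-integrable setT (EFin \o (fun w => b * sigma k w ^+ 2)).
    exact: (integrableZl measurableT b s2).
  have i3 : P.-integrable setT (EFin \o (fun w : T => c)).
    exact: finite_measure_integrable_cst.
  have i12 : P.-integrable setT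
      (EFin \o (fun w => a * inner k w + b * sigma k w ^+ 2)).
    exact: (integrableD measurableT i1 i2).
  split.
  - by move=> w; rewrite !addr_ge0// mulr_ge0// ?inner_ge0// sqr_ge0.
  - exact: (integrableD measurableT i12 i3).
  - rewrite (RintegralD measurableT i12 i3) (RintegralD measurableT i1 i2).
    by rewrite !RintegralZl// Rintegral_const.
have mQ : measurable_fun setT
    (fun w => dotv (g k w - F (xs k w)) (g k w - F (xs k w))).
  by apply: measurable_dotv; exact: vmeasurableB.
have [Q1 eQ] : P.-integrable setT
    (EFin \o (fun w => dotv (g k w - F (xs k w)) (g k w - F (xs k w)))) /\
  \int[P]_w dotv (g k w - F (xs k w)) (g k w - F (xs k w)) <=
    2 * A * \int[P]_w inner k w + B * \int[P]_w sigma k w ^+ 2 + D1.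
  have A20 : 0 <= 2 * A by rewrite mulr_ge0.
  have [W0 Wi <-] := affine _ _ _ A20 B0 D10.
  apply: (cond_exp_le_Rintegral (G_sigma k) (@G_meas k) mQ _ W0 Wi).
    by move=> w; exact: dotv_ge0.
  have := pa_second_moment pa k.
  by congr cond_exp_le; apply/funext => w; rewrite sqr_enorm.
have g2 : vL2 P (fun w => g k w - F (xs k w)).
  by split; [exact: vmeasurableB|exact: Q1].
have ms : measurable_fun setT (sigma k.+1).
  exact: (sub_measurable_fun (G_sigma k.+1) (@G_meas k.+1) (pa_sigma pa (k:=k.+1))).
split; [exact: F2|exact: (conj g2 eQ)| |].
  have C20 : 0 <= 2 * C by rewrite mulr_ge0.
  have rho0 : 0 <= 1 - rho by rewrite subr_ge0; case/andP: rho01.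
  have [W0 Wi <-] := affine _ _ _ C20 rho0 D20.
  apply: (cond_exp_le_Rintegral (G_sigma k) (@G_meas k) _ _ W0 Wi).
  - exact: measurable_funX.
  - by move=> w; exact: sqr_ge0.
  - exact: (pa_variance_reduction pa k).
apply: (@vL2_le _ _ _ _ _ _ (fun w => dotv (x k w - xs k w) (x k w - xs k w)
  - 2 * gamma * dotv (g k w - F (xs k w)) (x k w - xs k w)
  + gamma ^+ 2 * dotv (g k w - F (xs k w)) (g k w - F (xs k w)))).
- by apply: vmeasurableB; apply: vmeas; [exact: (pa_x pa)|exact: (pa_xstar pa)].
- have i1 := integrableZl measurableT (2 * gamma) (integrable_dotv g2 x2).
  have i2 := integrableZl measurableT (gamma ^+ 2) g2.2.
  exact: (integrableD measurableT (integrableB measurableT x2.2 i1) i2).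
- by move=> w; exact: dist2_step.
Qed.

Let moments k : vL2 P (fun w => x k w - xs k w) /\
  P.-integrable setT (EFin \o (fun w => sigma k w ^+ 2)).
Proof.
elim: k => [|k [x2 s2]]; last by have [_ _ [? _] ?] := moment_step x2 s2.
split; last first.
  by under eq_fun do rewrite sigmaE; exact: finite_measure_integrable_cst.
under eq_fun do rewrite x_sgda.1.
split; first by move=> i; exact: measurable_cst.
exact: finite_measure_integrable_cst.
Qed.

Let dist2 k : vL2 P (fun w => x k w - xs k w).
Proof. by have [] := moments k. Qed.

Let Fgap2 k : vL2 P (fun w => F (x k w) - F (xs k w)).
Proof. by have [x2 s2] := moments k; have [] := moment_step x2 s2. Qed.

Let noise2 k : vL2 P (fun w => g k w - F (xs k w)).
Proof. by have [x2 s2] := moments k; have [_ []] := moment_step x2 s2. Qed.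

Let error2 k : vL2 P (fun w => g k w - F (x k w)).
Proof.
have -> : (fun w => g k w - F (x k w)) =
    (fun w => (g k w - F (xs k w)) - (F (x k w) - F (xs k w))).
  by apply/funext => w; apply/rowP => i; rewrite !mxE; ring.
exact: (vL2B (noise2 k) (Fgap2 k)).
Qed.

Let error_orthogonal k (Z : T -> V) : vmeasurable_wrt (G k) Z -> vL2 P Z ->
  \int[P]_w dotv (g k w - F (x k w)) (Z w) = 0.
Proof.
exact: (vcond_exp_orthogonal (G_sigma k) (@G_meas k) (pa_unbiased pa k) (error2 k)).
Qed.

(** Passing through the projection of [x k] leaves [x0 - xs k], which is bounded because [Xs] is. *)
Let displacement2 k : vL2 P (fun w => x k w - x0).
Proof.
have -> : (fun w => x k w - x0) = (fun w => (x k w - xs k w) - (x0 - xs k w)).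
  by apply/funext => w; apply/rowP => i; rewrite !mxE; ring.
apply: (vL2B (dist2 k)); apply: (@vL2_le _ _ _ _ _ _ (fun=> S)).
- apply: vmeasurableB; first by move=> i; exact: measurable_cst.
  by apply: vmeas; exact: (pa_xstar pa).
- exact: finite_measure_integrable_cst.
- by move=> w; apply: Xs_bounded; exact: proj_on_in.
Qed.

Let noise_moment k := \int[P]_w dotv (g k w - F (xs k w)) (g k w - F (xs k w)).

Lemma sgda_noise_le (M : R) K : gamma * (2 * (A + B * C / rho)) <= 1 ->
  M = 4 * A + l + 8 * B * C / rho ->
  3 / 2 * gamma * \sum_(k < K)
    \int[P]_w dotv (g k w - F (xs k w)) (g k w - F (xs k w)) <=
  M * dotv (x0 - proj_on Xs x0) (x0 - proj_on Xs x0)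
  + (4 + M * gamma) * (gamma * (B / rho) * sigma0 ^+ 2)
  + K%:R * (gamma * (2 + gamma * M) * (D1 + 2 * (B / rho) * D2)).
Proof.
move=> step ME; have rho0 : 0 < rho by case/andP: rho01.
have H := @gradient_noise_le _
  (fun k => \int[P]_w dotv (x k w - xs k w) (x k w - xs k w))
  (fun k => \int[P]_w inner k w) (fun k => \int[P]_w sigma k w ^+ 2)
  noise_moment gamma A (B / rho) C D1 D2 rho.
have eN0 : \int[P]_w dotv (x 0%N w - xs 0%N w) (x 0%N w - xs 0%N w) =
    dotv (x0 - proj_on Xs x0) (x0 - proj_on Xs x0).
  by rewrite -[RHS]Rintegral_const; apply: eq_Rintegral => w _; rewrite x_sgda.1.
have eS0 : \int[P]_w sigma 0%N w ^+ 2 = sigma0 ^+ 2.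
  by rewrite -[RHS]Rintegral_const; apply: eq_Rintegral => w _; rewrite sigmaE.
rewrite -eN0 -eS0; apply: (H _ _ _ _ _ _ _ _ _ l) => //.
- by move=> k; apply: Rintegral_ge0 => w _; exact: dotv_ge0.
- by move=> k; apply: Rintegral_ge0 => w _; exact: inner_ge0.
- by move=> k; apply: Rintegral_ge0 => w _; exact: sqr_ge0.
- by rewrite divr_ge0// ltW.
- by rewrite mulrAC.
- move=> k.
  have i1 := integrable_dotv (noise2 k) (dist2 k).
  have i2 := integrable_dotv (error2 k) (dist2 k).
  have i3 := integrable_dotv (Fgap2 k) (dist2 k).
  (* Unbiasedness exchanges [F (x k)] for [g k]: their difference is orthogonal to the
     [G k]-measurable [x k - xs k]. *)
  have eWE : \int[P]_w inner k w =
      \int[P]_w dotv (g k w - F (xs k w)) (x k w - xs k w).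
    rewrite -[LHS]add0r.
    rewrite -(@error_orthogonal k (fun w => x k w - xs k w)) //; last first.
      by apply: vmeasurable_wrtB; [exact: (pa_x pa)|exact: (pa_xstar pa)].
    rewrite -RintegralD//; apply: eq_Rintegral => w _.
    exact: dotvB_chain.
  rewrite [X in 2 * gamma * X]eWE.
  have j1 : P.-integrable setT (EFin \o (fun w =>
      2 * gamma * dotv (g k w - F (xs k w)) (x k w - xs k w))).
    exact: (integrableZl measurableT (2 * gamma) i1).
  have j2 : P.-integrable setT (EFin \o (fun w =>
      gamma ^+ 2 * dotv (g k w - F (xs k w)) (g k w - F (xs k w)))).
    exact: (integrableZl measurableT (gamma ^+ 2) (noise2 k).2).
  have j0 : P.-integrable setT (EFin \o (fun w =>
      dotv (x k w - xs k w) (x k w - xs k w) -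
      2 * gamma * dotv (g k w - F (xs k w)) (x k w - xs k w))).
    exact: (integrableB measurableT (dist2 k).2 j1).
  rewrite -(RintegralZl (2 * gamma) measurableT i1)
    -(RintegralZl (gamma ^+ 2) measurableT (noise2 k).2).
  rewrite -(RintegralB measurableT (dist2 k).2 j1) -(RintegralD measurableT j0 j2).
  apply: (le_Rintegral measurableT (dist2 k.+1).2 (integrableD measurableT j0 j2)).
  move=> w _; exact: dist2_step.
- by move=> k; have [x2 s2] := moments k; have [_ [_ +]] := moment_step x2 s2;
    rewrite divfK ?gt_eqF.
- by move=> k; have [x2 s2] := moments k; have [_ _ []] := moment_step x2 s2.
- exact: ltW.
- by rewrite ME; field; rewrite gt_eqF.
Qed.

Let error_wrt k : vmeasurable_wrt (G k.+1) (fun w => g k w - F (x k w)).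
Proof.
apply: vmeasurable_wrtB; first exact: (pa_g pa).
move=> i; apply: (sub_measurable_wrt (G_sigma k) (G_sigma k.+1) (@G_incr k)).
exact: Fx_wrt.
Qed.

(** Pythagoras for [g - F xs = (g - F x) + (F x - F xs)], whose second summand is
    [G k]-measurable. *)
Let error_le_noise k :
  \int[P]_w dotv (g k w - F (x k w)) (g k w - F (x k w)) <= noise_moment k.
Proof.
have eF0 : \int[P]_w dotv (g k w - F (x k w)) (F (x k w) - F (xs k w)) = 0.
  apply: error_orthogonal (Fgap2 k).
  by apply: vmeasurable_wrtB; [exact: Fx_wrt|exact: (pa_gstar pa)].
have := Rintegral_pythagoras (error2 k) (Fgap2 k) eF0.
rewrite (@eq_Rintegral _ _ _ _ _
    (fun w => dotv (g k w - F (xs k w)) (g k w - F (xs k w)))); last first.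
  by move=> w _; rewrite addrA subrK.
rewrite /noise_moment => ->; rewrite lerDl.
by apply: Rintegral_ge0 => w _; exact: dotv_ge0.
Qed.

(** One induction proves all three claims: a partial sum measurable for [G K] is orthogonal to the
    next error, so second moments add. *)
Let error_sum K :
  [/\ vmeasurable_wrt (G K) (fun w => \sum_(k < K) (g k w - F (x k w))),
      vL2 P (fun w => \sum_(k < K) (g k w - F (x k w)))
    & \int[P]_w dotv (\sum_(k < K) (g k w - F (x k w)))
                     (\sum_(k < K) (g k w - F (x k w)))
      <= \sum_(k < K) noise_moment k].
Proof.
elim: K => [|K [mS S2 IH]].
  rewrite big_ord0; under eq_fun do rewrite big_ord0.
  split; first exact: vmeasurable_wrt_cst.
  - split; first by move=> i; exact: measurable_cst.
    exact: finite_measure_integrable_cst.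
  - rewrite (@eq_Rintegral _ _ _ _ _ (fun=> 0)) ?Rintegral_const//.
    by move=> w _; rewrite big_ord0 dotv0l.
have -> : (fun w => \sum_(k < K.+1) (g k w - F (x k w))) =
    (fun w => \sum_(k < K) (g k w - F (x k w)) + (g K w - F (x K w))).
  by apply/funext => w; rewrite big_ord_recr.
split.
- apply: vmeasurable_wrtD; last exact: error_wrt.
  move=> i; apply: (sub_measurable_wrt (G_sigma K) (G_sigma K.+1) (@G_incr K)).
  exact: mS.
- exact: (vL2D S2 (error2 K)).
- rewrite big_ord_recr (@eq_Rintegral _ _ _ _ _ (fun w =>
    dotv (\sum_(k < K) (g k w - F (x k w)) + (g K w - F (x K w)))
         (\sum_(k < K) (g k w - F (x k w)) + (g K w - F (x K w))))); last first.
    by move=> w _; rewrite big_ord_recr.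
  rewrite (Rintegral_pythagoras S2 (error2 K)) ?(lerD IH (error_le_noise K))//.
  under eq_Rintegral do rewrite dotvC.
  exact: error_orthogonal.
Qed.

Lemma sgda_gap_le (Cs : set V) (M O : R) K :
  Xs !=set0 -> Xs `<=` Cs ->
  (forall u, Cs u -> dotv (x0 - u) (x0 - u) <= S) ->
  (forall u, Xs u -> dotv (F u) (F u) <= M) ->
  (forall u v, Cs u -> Cs v -> dotv (u - v) (u - v) <= O) ->
  (1 <= K)%N ->
  (\int[P]_w gap F r Cs (K%:R^-1 *: \sum_(1 <= k < K.+1) x k w)%R <=
   ((2 * gamma * K%:R)^-1 *
    (5 / 2 * S + 6 * gamma ^+ 2 * (M + l ^+ 2 * O) + 2 * gamma ^+ 2 * K%:R * M
     + 3 * gamma ^+ 2 * \sum_(k < K)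
         \int[P]_w dotv (g k w - F (xs k w)) (g k w - F (xs k w))))%:E)%E.
Proof.
move=> X0 XC CS XM CO K0.
set c := 5 / 2 * S + 6 * gamma ^+ 2 * (M + l ^+ 2 * O) + 2 * gamma ^+ 2 * K%:R * M.
pose q w := \sum_(k < K) dotv (g k w - F (xs k w)) (g k w - F (xs k w)).
pose m w := \sum_(k < K) dotv (g k w - F (x k w)) (x k w - x0).
pose e w := dotv (\sum_(k < K) (g k w - F (x k w))) (\sum_(k < K) (g k w - F (x k w))).
have iq : P.-integrable setT (EFin \o q).
  by apply: integrable_sumr => k; exact: (noise2 k).2.
have im : P.-integrable setT (EFin \o m).
  by apply: integrable_sumr => k; exact: (integrable_dotv (error2 k) (displacement2 k)).
have [_ [_ ie] le_e] := error_sum K.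
(* Each [x k - x0] is [G k]-measurable, hence orthogonal to the error of step [k]. *)
have m0 : \int[P]_w m w = 0.
  rewrite Rintegral_sum; last first.
    by move=> k; exact: (integrable_dotv (error2 k) (displacement2 k)).
  apply: big1 => k _; apply: error_orthogonal (displacement2 k).
  by apply: vmeasurable_wrtB; [exact: (pa_x pa)|exact: vmeasurable_wrt_cst].
have qE : \int[P]_w q w = \sum_(k < K) noise_moment k.
  by apply: Rintegral_sum => k; exact: (noise2 k).2.
have iq' : P.-integrable setT (EFin \o (fun w => 2 * gamma ^+ 2 * q w)).
  exact: (integrableZl measurableT (2 * gamma ^+ 2) iq).
have im' : P.-integrable setT (EFin \o (fun w => 2 * gamma * m w)).
  exact: (integrableZl measurableT (2 * gamma) im).
have ie' : P.-integrable setT (EFin \o (fun w => gamma ^+ 2 * e w)).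
  exact: (integrableZl measurableT (gamma ^+ 2) ie).
have iqm : P.-integrable setT
    (EFin \o (fun w => 2 * gamma ^+ 2 * q w - 2 * gamma * m w)).
  exact: (integrableB measurableT iq' im').
have iqme : P.-integrable setT
    (EFin \o (fun w => 2 * gamma ^+ 2 * q w - 2 * gamma * m w + gamma ^+ 2 * e w)).
  exact: (integrableD measurableT iqm ie').
have ic : P.-integrable setT (EFin \o (fun _ : T => c)).
  exact: finite_measure_integrable_cst.
have ih : P.-integrable setT (EFin \o (fun w =>
    c + (2 * gamma ^+ 2 * q w - 2 * gamma * m w + gamma ^+ 2 * e w))).
  exact: (integrableD measurableT ic iqme).
have K1 : (0 : R) < K%:R by rewrite ltr0n.
have gK : 0 <= (2 * gamma * K%:R)^-1 by rewrite invr_ge0 !mulr_ge0// ltW.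
pose h w := (2 * gamma * K%:R)^-1 *
  (c + (2 * gamma ^+ 2 * q w - 2 * gamma * m w + gamma ^+ 2 * e w)).
have ihh : P.-integrable setT (EFin \o h).
  exact: (integrableZl measurableT (2 * gamma * K%:R)^-1 ih).
apply: (@le_trans _ _ (\int[P]_w (h w)%:E)%E).
  apply: ge0_integral_mono => w; first exact: gap_ge0 XsE X0 XC.
  have := @gap_mean_le _ _ gamma l S M O F r Xs Cs (x ^~ w) (g ^~ w) K
    r_proper r_convex gamma0 F_mono Xs_proj l0 F_star XC (x_sgda.2 ^~ w).
  by rewrite x_sgda.1; apply.
rewrite -[leLHS](fineK (integrable_fin_num measurableT ihh)) lee_fin.
rewrite -[leLHS]/(\int[P]_w h w).
rewrite (RintegralZl _ measurableT ih) ler_wpM2l//.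
rewrite (RintegralD measurableT ic iqme) (RintegralD measurableT iqm ie').
rewrite (RintegralB measurableT iq' im') (RintegralZl _ measurableT iq).
rewrite (RintegralZl _ measurableT im) (RintegralZl _ measurableT ie).
rewrite Rintegral_const m0 qE mulr0 subr0 lerD2l.
(* The factor 3 is the 2 in front of [q] plus 1 from [e]. *)
have := ler_wpM2l (sqr_ge0 gamma) le_e.
by move: (Rintegral _ _ _) (\sum_(k < K) _) => a b ?; lra.
Qed.

End sgda_moments.

(** * Final constants and infinite suprema *)

Section final_bound.
Context {R : realType}.

(** With positive coefficients, an infinite supremum makes the right-hand side [+oo]; otherwise the
    inequality is one between reals. *)
Lemma lee_sup_cases (a b c e : R) (X s m o : \bar R) :
  0 < a -> 0 < b -> 0 < c -> (0 <= s)%E -> (0 <= m)%E -> (0 <= o)%E ->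
  (forall s' m' o' : R, s = s'%:E -> m = m'%:E -> o = o'%:E ->
    (X <= (a * s' + b * m' + c * o' ^+ 2 + e)%:E)%E) ->
  (X <= a%:E * s + b%:E * m + c%:E * o ^+ 2 + e%:E)%E.
Proof.
move=> a0 b0 c0 s0 m0 o0 H.
have nonneg (t : R) (y : \bar R) : 0 < t -> (0 <= y)%E -> (t%:E * y != -oo)%E.
  by move=> t0 y0; rewrite gt_eqF// (lt_le_trans (ltNyr 0))// mule_ge0// lee_fin ltW.
have o20 : (0 <= o ^+ 2)%E by rewrite expe_ge0.
have [sy|sy] := eqVneq s +oo%E.
  by rewrite sy gt0_muley ?lte_fin// !addye ?leey// nonneg.
have [my|my] := eqVneq m +oo%E.
  by rewrite my [(b%:E * _)%E]gt0_muley ?lte_fin// addey ?nonneg// !addye ?leey// nonneg.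
have [oy|oy] := eqVneq o +oo%E.
  rewrite oy expe2 mulyy [(c%:E * _)%E]gt0_muley ?lte_fin// addey ?addye ?leey//.
  by rewrite gt_eqF// (lt_le_trans (ltNyr 0))// adde_ge0// mule_ge0// lee_fin ltW.
have sE : s = (fine s)%:E by rewrite fineK// ge0_fin_numE// ltey.
have mE : m = (fine m)%:E by rewrite fineK// ge0_fin_numE// ltey.
have oE : o = (fine o)%:E by rewrite fineK// ge0_fin_numE// ltey.
by rewrite sE mE oE -EFin_expe -!EFinM -!EFinD; exact: H.
Qed.

(** After division by [2 gamma K] the coefficients compare as [5 / 4 <= 3 / 2] for [S],
    [1 + 3 / K <= 9] for [M], and [3 <= 8] for [O], which is the squared diameter. *)
Lemma gap_bound_le (gamma K S M O l E N e : R) :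
  0 < gamma -> 1 <= K -> 0 <= S -> 0 <= M -> 0 <= O ->
  3 / 2 * gamma * E <= N -> e = N / K ->
  (2 * gamma * K)^-1 *
    (5 / 2 * S + 6 * gamma ^+ 2 * (M + l ^+ 2 * O) + 2 * gamma ^+ 2 * K * M
     + 3 * gamma ^+ 2 * E) <=
  3 / (2 * gamma * K) * S + 9 * gamma * M + 8 * gamma * l ^+ 2 / K * O + e.
Proof.
move=> g0 K1 S0 M0 O0 EN ->.
have K0 : 0 < K by lra.
have Kn : K != 0 by rewrite gt_eqF.
have gn : gamma != 0 by rewrite gt_eqF.
have -> : (2 * gamma * K)^-1 *
    (5 / 2 * S + 6 * gamma ^+ 2 * (M + l ^+ 2 * O) + 2 * gamma ^+ 2 * K * M
     + 3 * gamma ^+ 2 * E) =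
  5 / 4 * (gamma^-1 * K^-1 * S) + 3 * (K^-1 * (gamma * M))
    + 3 * (K^-1 * (gamma * (l ^+ 2 * O))) + gamma * M
    + K^-1 * (3 / 2 * gamma * E) by field; rewrite gn Kn.
have -> : 3 / (2 * gamma * K) * S + 9 * gamma * M + 8 * gamma * l ^+ 2 / K * O
    + N / K =
  3 / 2 * (gamma^-1 * K^-1 * S) + 9 * (gamma * M)
    + 8 * (K^-1 * (gamma * (l ^+ 2 * O))) + K^-1 * N by field; rewrite gn Kn.
have g0W := ltW g0.
have gi : 0 <= gamma^-1 by rewrite invr_ge0 ltW.
have Ki : 0 <= K^-1 by rewrite invr_ge0 ltW.
have K1i : K^-1 <= 1 by rewrite invf_le1.
have P1 : 0 <= gamma^-1 * K^-1 * S by rewrite !mulr_ge0.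
have P2 : 0 <= gamma * M by rewrite mulr_ge0// ltW.
have P3 : K^-1 * (gamma * M) <= gamma * M by rewrite ler_piMl.
have P4 : 0 <= K^-1 * (gamma * (l ^+ 2 * O)) by rewrite mulr_ge0// mulr_ge0// mulr_ge0// sqr_ge0.
have P5 : K^-1 * (3 / 2 * gamma * E) <= K^-1 * N by rewrite ler_wpM2l.
by lra.
Qed.

End final_bound.

(* The inverse in the stepsize bound is that of \bar R, with 0^-1 = +oo: there
   is no upper bound on gamma when A + B C / rho = 0.  The maxima on the
   right-hand side are suprema in \bar R. *)
Theorem theorem2p5 (R : realType) (n : nat)
  (d : measure_display) (T : measurableType d) (P : probability T R)
  (F : 'rV[R]_n -> 'rV[R]_n) (r : 'rV[R]_n -> \bar R)
  (Xs : set 'rV[R]_n) (Cs : set 'rV[R]_n)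
  (G : nat -> set (set T))
  (x g : nat -> T -> 'rV[R]_n) (sigma : nat -> T -> R)
  (x0 : 'rV[R]_n) (sigma0 : R)
  (l gamma A B C D1 D2 rho : R) :
  proper_fun r -> lower_semicontinuous r -> convex_efun r ->
  Xs = vi_solutions F r -> Xs !=set0 -> proj_well_defined Xs ->
  monotone_op F ->
  0 < l -> star_cocoercive F Xs l ->
  0 <= A -> 0 <= B -> 0 <= C -> 0 <= D1 -> 0 <= D2 -> 0 < rho <= 1 ->
  (forall w, sigma 0%N w = sigma0) ->
  parametric_assumption P G F Xs x g sigma A B C D1 D2 rho ->
  compact Cs -> convex_set Cs -> Xs `<=` Cs ->
  0 < gamma -> (gamma%:E <= (2 * (A + B * C / rho))%:E^-1)%E ->
  sgda gamma r x0 x g ->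
  forall K : nat, (1 <= K)%N ->
  let M : R := 4 * A + l + 8 * B * C / rho in
  (\int[P]_w gap F r Cs (K%:R^-1 *: \sum_(1 <= k < K.+1) x k w)%R
   <= (3 / (2 * gamma * K%:R))%:E
        * ereal_sup [set (enorm (x0 - u) ^+ 2)%:E | u in Cs]
      + (9 * gamma)%:E * ereal_sup [set (enorm (F xs) ^+ 2)%:E | xs in Xs]
      + (8 * gamma * l ^+ 2 / K%:R)%:E * diameter Cs ^+ 2
      + (M * enorm (x0 - proj_on Xs x0) ^+ 2 / K%:R
         + (4 + M * gamma) * (gamma * B * sigma0 ^+ 2 / (rho * K%:R))
         + gamma * (2 + gamma * M) * (D1 + 2 * B * D2 / rho))%:E)%E.
Proof.
move=> pr _ cr XsE X0 pw mF l0 lF A0 B0 C0 D10 D20 rho01 sE pa _ _ XC g0 step sg.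
move=> K K0; set M := 4 * A + l + 8 * B * C / rho.
have rho0 : 0 < rho by case/andP: rho01.
have K1 : 1 <= K%:R :> R by rewrite ler1n.
(* The solution [c] keeps all three suprema over nonempty sets, hence nonnegative. *)
have [c Xc] := X0; have Cc := XC _ Xc.
(* Multiplying out covers the case of a zero denominator, where the product is 0. *)
have stepR : gamma * (2 * (A + B * C / rho)) <= 1.
  move: step; rewrite inver; case: eqVneq => [->|s0]; first by rewrite mulr0 ler01.
  rewrite lee_fin -[_^-1]mul1r ler_pdivlMr// lt_neqAle eq_sym s0/=.
  by rewrite mulr_ge0// addr_ge0// divr_ge0 ?mulr_ge0// ltW.
apply: lee_sup_cases.
- by rewrite divr_gt0// !mulr_gt0// ltr0n.
- by rewrite mulr_gt0.
- by rewrite !mulr_gt0 ?invr_gt0 ?ltr0n// exprn_gt0.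
- apply: (@le_trans _ _ ((enorm (x0 - c) ^+ 2))%:E); first by rewrite lee_fin sqr_ge0.
  by apply: ereal_sup_ubound; exists c.
- apply: (@le_trans _ _ ((enorm (F c) ^+ 2))%:E); first by rewrite lee_fin sqr_ge0.
  by apply: ereal_sup_ubound; exists c.
- apply: (@le_trans _ _ ((enorm (c - c)))%:E); first by rewrite lee_fin enorm_ge0.
  by apply: ereal_sup_ubound; exists c, c.
move=> s m o sS mM oO.
have CS u : Cs u -> dotv (x0 - u) (x0 - u) <= s.
  move=> Cu; rewrite -sqr_enorm -lee_fin -sS.
  by apply: ereal_sup_ubound; exists u.
have XM u : Xs u -> dotv (F u) (F u) <= m.
  move=> Xu; rewrite -sqr_enorm -lee_fin -mM.
  by apply: ereal_sup_ubound; exists u.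
have CO u v : Cs u -> Cs v -> dotv (u - v) (u - v) <= o ^+ 2.
  move=> Cu Cv; rewrite -sqr_enorm.
  have : enorm (u - v) <= o.
    by rewrite -lee_fin -oO; apply: ereal_sup_ubound; exists u, v.
  by move=> uv; rewrite lerXn2r ?nnegrE ?(le_trans _ uv) ?enorm_ge0.
have noise := sgda_noise_le pr cr XsE pw mF l0 lF A0 B0 C0 D10 D20 rho01 sE pa
  g0 sg K stepR (erefl M).
have XS u : Xs u -> dotv (x0 - u) (x0 - u) <= s by move=> /XC; exact: CS.
apply: le_trans (sgda_gap_le pr cr XsE pw mF l0 lF A0 B0 C0 D10 D20 rho01 sE pa
  g0 sg XS X0 XC CS XM CO K0) _.
rewrite lee_fin; apply: gap_bound_le noise _ => //.
- exact: le_trans (dotv_ge0 _) (CS _ Cc).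
- exact: le_trans (dotv_ge0 _) (XM _ Xc).
- exact: sqr_ge0.
- by rewrite sqr_enorm; field; rewrite !gt_eqF// ltr0n.
Qed.
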